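(* Let $M=U\Sigma V^\top\in\mathbb R^{m\times n}$ have rank $r$ (compact SVD), and let $S\in\mathbb R^{m\times s}$, $P\in\mathbb R^{n\times c}$ be selection matrices such that $(S,P)$ is admissible for $M$, i.e. $\operatorname{rank}(S^\top U)=r$ and $\operatorname{rank}(V^\top P)=r$. Define $\Phi_r(A)=AP\,(S^\top A P)_r^\dagger\, S^\top A$, and put $\Pi_U=U(S^\top U)^\dagger S^\top$, $\Pi_V=P(V^\top P)^\dagger V^\top$. Then: (i) $\Phi_r$ is (Fréchet) differentiable at $M$, and for every $E\in\mathbb R^{m\times n}$, $$D\Phi_r(M)[E]=\Pi_U E+E\Pi_V-\Pi_U E\Pi_V=\mathcal I_{T_M}^{S,P}(E).$$ (ii) Consequently, for all sufficiently small $E$, $$\Phi_r(M+E)=M+\mathcal I_{T_M}^{S,P}(E)+O(\|E\|^2),$$ where the remainder is measured in any fixed matrix norm; that is, for every fixed norm $\|\cdot\|$ on $\mathbb R^{m\times n}$ there are constants $C,\delta>0$, independent of $E$, with $\|\Phi_r(M+E)-M-\mathcal I_{T_M}^{S,P}(E)\|\le C\|E\|^2$ whenever $\|E\|\le\delta$. (iii) For any fixed $0<\kappa<1/2$, the rank-truncation step is controlled whenever $\|S^\top E P\|_2\le\kappa\,\sigma_r(S^\top M P)$, in the following sense: with $W=S^\top M P$ and $\Delta=S^\top E P$, one has $(W+\Delta)_r=W+\mathcal P_{T_W}\Delta+R$ with $\|R\|_2\le\frac{12-16\kappa}{1-2\kappa}\,\frac{\|\Delta\|_2^2}{\sigma_r(W)}$.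 (The constant in the $O(\|E\|^2)$ term of (ii) is allowed to depend on $M,S,P,r$, the chosen norm, and $\kappa$.)
   Context: Compact SVD: $M=U\Sigma V^\top$ with $U\in\mathbb R^{m\times r}$, $V\in\mathbb R^{n\times r}$, $U^\top U=V^\top V=I_r$, $\Sigma=\operatorname{diag}(\sigma_1,\dots,\sigma_r)$, $\sigma_1\ge\cdots\ge\sigma_r>0$, $r\ge1$. Selection matrices: the columns of $S\in\mathbb R^{m\times s}$ and $P\in\mathbb R^{n\times c}$ are distinct columns of $I_m$ and $I_n$ respectively, so $S^\top S=I_s$, $P^\top P=I_c$; $S^\top A$ consists of selected rows of $A$ and $AP$ of selected columns. $X^\dagger$ is the Moore–Penrose pseudoinverse; $\|\cdot\|_2$ is the spectral norm; $\sigma_r(X)$ is the $r$-th largest singular value of $X$. $X_r$ denotes the best rank-$r$ approximation of $X$ obtained by truncating the SVD (unique when $\sigma_r(X)>\sigma_{r+1}(X)$, which holds for $X=S^\top(M+E)P$ with $E$ small; otherwise any choice). $(S^\top AP)_r^\dagger$ means the pseudoinverse of $(S^\top AP)_r$. The sampling-induced oblique tangent projector is the linear operator $\mathcal I_{T_M}^{S,P}(E)=\Pi_U E+E\Pi_V-\Pi_U E\Pi_V$ on $\mathbb R^{m\times n}$. For a rank-$r$ matrix $W\in\mathbb R^{s\times c}$ with compact SVD $W=Q\Lambda Z^\top$, $\mathcal P_{T_W}X=QQ^\top X+XZZ^\top-QQ^\top XZZ^\top$. A map $F$ between matrix spaces is Fréchet differentiable at $X$ if there is a linear map $DF(X)$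 with $\|F(X+H)-F(X)-DF(X)[H]\|/\|H\|\to0$ as $H\to0$. *)

(* Defs.v *)
From HB Require Import structures.
From mathcomp Require Import all_boot all_order all_algebra.
From mathcomp Require Import all_classical all_reals all_analysis.

Set Implicit Arguments.
Unset Strict Implicit.
Unset Printing Implicit Defensive.

Import Order.TTheory GRing.Theory Num.Theory.
Import numFieldNormedType.Exports.

Local Open Scope classical_set_scope.
Local Open Scope ring_scope.

Section Matrices.
Context {R : realType}.

Definition selection_mx (m s : nat) (S : 'M[R]_(m, s)) : Prop :=
  exists2 f : 'I_s -> 'I_m, injective f & S = colsub f 1%:M.

(* [k] is necessarily the rank of [X]; [k = 0] is allowed here and gives the
   zero matrix. *)
Definition compact_svd (m n k : nat) (X : 'M[R]_(m, n))
    (U : 'M[R]_(m, k)) (d : 'rV[R]_k) (V : 'M[R]_(n, k)) : Prop :=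
  [/\ U^T *m U = 1%:M,
      V^T *m V = 1%:M,
      forall i j : 'I_k, (i <= j)%N -> d 0 j <= d 0 i,
      forall i : 'I_k, 0 < d 0 i
    & X = U *m diag_mx d *m V^T].

(* [Y] is obtained from some SVD of [X] by keeping its first [r] terms, all of
   them if [X] has rank less than [r].  This is a relation because the SVD, and
   with it [Y] when sigma_r(X) = sigma_(r+1)(X), need not be unique. *)
Definition svd_truncation (m n : nat) (r : nat) (X Y : 'M[R]_(m, n)) : Prop :=
  exists (k : nat) (U : 'M[R]_(m, k)) (d : 'rV[R]_k) (V : 'M[R]_(n, k)),
    compact_svd X U d V /\
    Y = U *m diag_mx (\row_(i < k) if (i < r)%N then d 0 i else 0) *m V^T.

(* The [j]-th largest singular value, counted from [j = 1]; it is 0 when [j]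
   exceeds the rank. *)
Definition singular_value (m n : nat) (j : nat) (X : 'M[R]_(m, n)) : R :=
  xget 0 [set x : R |
    exists (k : nat) (U : 'M[R]_(m, k)) (d : 'rV[R]_k) (V : 'M[R]_(n, k)),
      compact_svd X U d V /\ x = [seq d 0 i | i : 'I_k]`_j.-1].

Definition penrose (m n : nat) (X : 'M[R]_(m, n)) (Y : 'M[R]_(n, m)) : Prop :=
  [/\ X *m Y *m X = X,
      Y *m X *m Y = Y,
      (X *m Y)^T = X *m Y
    & (Y *m X)^T = Y *m X].

Definition pinv (m n : nat) (X : 'M[R]_(m, n)) : 'M[R]_(n, m) :=
  xget 0 [set Y | penrose X Y].

Definition euclid_norm (n : nat) (v : 'cV[R]_n) : R :=
  Num.sqrt (\sum_(i < n) v i 0 ^+ 2).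

Definition spectral_norm (m n : nat) (X : 'M[R]_(m, n)) : R :=
  sup [set euclid_norm (X *m v) | v in [set v | euclid_norm v <= 1]].

(* Nonnegativity of [N] follows from these axioms. *)
Definition is_norm (V : lmodType R) (N : V -> R) : Prop :=
  [/\ forall x y, N (x + y) <= N x + N y,
      forall (a : R) x, N (a *: x) = `|a| * N x
    & forall x, N x = 0 -> x = 0].

Section Oblique.
Variables (m n s c r : nat).
Variables (S : 'M[R]_(m, s)) (P : 'M[R]_(n, c)).

Definition admissible (U : 'M[R]_(m, r)) (V : 'M[R]_(n, r)) : Prop :=
  \rank (S^T *m U) = r /\ \rank (V^T *m P) = r.

Definition oblique_left (U : 'M[R]_(m, r)) : 'M[R]_m :=
  U *m pinv (S^T *m U) *m S^T.

Definition oblique_right (V : 'M[R]_(n, r)) : 'M[R]_n :=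
  P *m pinv (V^T *m P) *m V^T.

Definition oblique_tangent_proj (U : 'M[R]_(m, r)) (V : 'M[R]_(n, r))
    (E : 'M[R]_(m, n)) : 'M[R]_(m, n) :=
  oblique_left U *m E + E *m oblique_right V
  - oblique_left U *m E *m oblique_right V.

(* [T] is the choice of rank-[r] truncations, [T X] = X_r. *)
Definition CUR_map (T : 'M[R]_(s, c) -> 'M[R]_(s, c))
    (A : 'M[R]_(m, n)) : 'M[R]_(m, n) :=
  A *m P *m pinv (T (S^T *m A *m P)) *m (S^T *m A).

End Oblique.

(* The orthogonal projector P_(T_W) onto the tangent space at a matrix [W]
   with compact SVD W = Q L Z^T. *)
Definition tangent_proj (s c r : nat) (Q : 'M[R]_(s, r)) (Z : 'M[R]_(c, r))
    (X : 'M[R]_(s, c)) : 'M[R]_(s, c) :=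
  Q *m Q^T *m X + X *m (Z *m Z^T) - Q *m Q^T *m X *m (Z *m Z^T).

End Matrices.

(* Main.v *)
Require Import Defs.
From HB Require Import structures.
From mathcomp Require Import all_boot all_order all_algebra.
From mathcomp Require Import all_classical all_reals all_analysis.
From mathcomp Require Import ring lra.

(** Let W = S^T M P, D = S^T E P, |.| the spectral norm, and let Y be a rank-r
    truncation of X = W + D, with residual N = X - Y.  The residual is
    biorthogonal to Y, and Weyl's inequality gives |N| <= |D|.  With
    G = Y - W, q = Q Q^T, z = Z Z^T,
      Y - W - P_T(D) = (1-q) G Y^+ G (1-z) - q N - (1-q) N z,
    where q N = - (W^+)^T G^T N because Y^T N = 0, and symmetrically for N z:
    every term is quadratic in D, which is (iii).

    Admissibility gives M P = B W and S^T M = W C with B = U (S^T U)^+ and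
    C = (V^T P)^+ V^T, so Phi(M + E) = (B W + E P) Y^+ (W C + S^T E).  Since
    Y^+ N = 0 and N Y^+ = 0, W Y^+ W = Y - D Y^+ Y - Y Y^+ D + D Y^+ D, whose
    first order part is W - q D z: no expansion of Y^+ itself is needed, only
    that Y Y^+ and Y^+ Y are within O(|D|) of q and z.  This is (ii) for the
    spectral norm, and equivalence of norms gives (ii) in general and (i). *)

Set Implicit Arguments.
Unset Strict Implicit.
Unset Printing Implicit Defensive.

Import Order.TTheory GRing.Theory Num.Theory.
Import numFieldNormedType.Exports.

Local Open Scope classical_set_scope.
Local Open Scope ring_scope.

(** * Euclidean norm of column vectors and the Cauchy-Schwarz inequality *)

Section EuclideanNorm.
Context {R : realType}.
Implicit Types n m : nat.

Lemma euclid_norm_ge0 n (v : 'cV[R]_n) : 0 <= euclid_norm v.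
Proof. exact: sqrtr_ge0. Qed.

Lemma sqr_euclid_norm n (v : 'cV[R]_n) :
  euclid_norm v ^+ 2 = \sum_(i < n) v i 0 ^+ 2.
Proof. by rewrite sqr_sqrtr // sumr_ge0 // => i _; exact: sqr_ge0. Qed.

Lemma sqr_euclid_normE n (v : 'cV[R]_n) :
  euclid_norm v ^+ 2 = (v^T *m v) 0 0.
Proof. by rewrite sqr_euclid_norm mxE; apply: eq_bigr => i _; rewrite mxE expr2. Qed.

Lemma euclid_norm_eq0 n (v : 'cV[R]_n) : euclid_norm v = 0 -> v = 0.
Proof.
move=> v0; apply/matrixP => i j; rewrite ord1 mxE; apply/eqP.
have /eqP := sqr_euclid_norm v; rewrite v0 expr0n /= eq_sym psumr_eq0 => [|k _].
  by move=> /allP /(_ i); rewrite mem_index_enum sqrf_eq0 => /(_ isT).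
exact: sqr_ge0.
Qed.

Lemma euclid_normZ n a (v : 'cV[R]_n) : euclid_norm (a *: v) = `|a| * euclid_norm v.
Proof.
apply/eqP; rewrite -(eqrXn2 (ltn0Sn 1)) ?mulr_ge0 ?euclid_norm_ge0 //.
rewrite exprMn !sqr_euclid_norm real_normK ?num_real // mulr_sumr.
by apply/eqP/eq_bigr => i _; rewrite mxE exprMn.
Qed.

Lemma euclid_norm0 n : euclid_norm (0 : 'cV[R]_n) = 0.
Proof. by rewrite -(scale0r 0) euclid_normZ normr0 mul0r. Qed.

Lemma euclid_normN n (v : 'cV[R]_n) : euclid_norm (- v) = euclid_norm v.
Proof. by rewrite -scaleN1r euclid_normZ normrN1 mul1r. Qed.

(** Cauchy-Schwarz: with a = |u|, b = |v| and p = u^T v, the square of |b u - a v| equals 2 a b (a b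
    - p), and a b can be cancelled once both norms are nonzero. *)
Lemma dotmx_le n (u v : 'cV[R]_n) :
  (u^T *m v) 0 0 <= euclid_norm u * euclid_norm v.
Proof.
have [u0|u_neq0] := eqVneq (euclid_norm u) 0.
  by rewrite u0 mul0r (euclid_norm_eq0 u0) trmx0 mul0mx mxE.
have [v0|v_neq0] := eqVneq (euclid_norm v) 0.
  by rewrite v0 mulr0 (euclid_norm_eq0 v0) mulmx0 mxE.
set a := euclid_norm u in u_neq0 *; set b := euclid_norm v in v_neq0 *.
have a_gt0 : 0 < a by rewrite lt_def u_neq0 euclid_norm_ge0.
have b_gt0 : 0 < b by rewrite lt_def v_neq0 euclid_norm_ge0.
have := sqr_ge0 (euclid_norm (b *: u - a *: v)).
have uv : (v^T *m u) 0 0 = (u^T *m v) 0 0.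
  by rewrite -[v in RHS]trmxK -trmx_mul [RHS]mxE.
have addE (A B : 'M[R]_1) : (A + B) 0 0 = A 0 0 + B 0 0 by rewrite mxE.
have oppE (A : 'M[R]_1) : (- A) 0 0 = - A 0 0 by rewrite mxE.
have scaleE x (A : 'M[R]_1) : (x *: A) 0 0 = x * A 0 0 by rewrite mxE.
rewrite sqr_euclid_normE [(_ - _)^T]linearB /= ![(_ *: _)^T]linearZ /= mulmxBl !mulmxBr.
rewrite -!scalemxAl -!scalemxAr !(addE, oppE, scaleE) uv -!sqr_euclid_normE.
rewrite -/a -/b; move: (_ 0 0) => p h.
have : 0 <= 2 * (a * b) * (a * b - p) by apply: le_trans h _; lra.
by rewrite pmulr_rge0 ?mulr_gt0 // subr_ge0.
Qed.

Lemma euclid_normD n (u v : 'cV[R]_n) :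
  euclid_norm (u + v) <= euclid_norm u + euclid_norm v.
Proof.
rewrite -ler_sqr ?nnegrE ?addr_ge0 ?euclid_norm_ge0 //.
have := dotmx_le u v; have := dotmx_le v u.
rewrite sqr_euclid_normE [(_ + _)^T]linearD /= mulmxDl !mulmxDr.
have addE (A B : 'M[R]_1) : (A + B) 0 0 = A 0 0 + B 0 0 by rewrite mxE.
by rewrite !addE -!sqr_euclid_normE; lra.
Qed.

End EuclideanNorm.

(** * The spectral norm as an operator norm *)

Section SpectralNorm.
Context {R : realType}.
Implicit Types m n p k : nat.

Lemma ler_entry_euclid_norm n (v : 'cV[R]_n) i : `|v i 0| <= euclid_norm v.
Proof.
rewrite -ler_sqr ?nnegrE ?euclid_norm_ge0 // real_normK ?num_real //.
rewrite sqr_euclid_norm (bigD1 i) //= lerDl sumr_ge0 // => j _.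
exact: sqr_ge0.
Qed.

Lemma euclid_norm_sum n (I : Type) (r : seq I) (F : I -> 'cV[R]_n) :
  euclid_norm (\sum_(i <- r) F i) <= \sum_(i <- r) euclid_norm (F i).
Proof.
elim: r => [|i r IHr]; first by rewrite !big_nil euclid_norm0.
by rewrite !big_cons (le_trans (euclid_normD _ _)) // lerD2l.
Qed.

(** A crude bound, used only to show that the supremum defining the spectral norm is finite. *)
Lemma euclid_norm_mulmx_le_cols m n (X : 'M[R]_(m, n)) v :
  euclid_norm (X *m v) <= (\sum_j euclid_norm (col j X)) * euclid_norm v.
Proof.
have -> : X *m v = \sum_j v j 0 *: col j X.
  apply/colP => i; rewrite mxE summxE; apply: eq_bigr => j _.
  by rewrite !mxE mulrC.
rewrite (le_trans (euclid_norm_sum _ _)) // mulr_suml ler_sum // => j _.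
by rewrite euclid_normZ mulrC ler_wpM2l ?euclid_norm_ge0 ?ler_entry_euclid_norm.
Qed.

Lemma has_sup_spectral_norm m n (X : 'M[R]_(m, n)) :
  has_sup [set euclid_norm (X *m v) | v in [set v | euclid_norm v <= 1]].
Proof.
split; first by exists (euclid_norm (X *m 0)), 0; rewrite //= euclid_norm0.
exists (\sum_j euclid_norm (col j X)) => _ [v /= v1 <-].
rewrite (le_trans (euclid_norm_mulmx_le_cols _ _)) // ler_piMr //.
by rewrite sumr_ge0 // => j _; exact: euclid_norm_ge0.
Qed.

Lemma spectral_norm_ge0 m n (X : 'M[R]_(m, n)) : 0 <= spectral_norm X.
Proof.
apply: le_trans (euclid_norm_ge0 (X *m 0)) _.
apply: ub_le_sup; first by case: (has_sup_spectral_norm X).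
by exists 0; rewrite //= euclid_norm0.
Qed.

Lemma euclid_norm_mulmx m n (X : 'M[R]_(m, n)) v :
  euclid_norm (X *m v) <= spectral_norm X * euclid_norm v.
Proof.
have [v0|v_neq0] := eqVneq (euclid_norm v) 0.
  by rewrite v0 (euclid_norm_eq0 v0) mulmx0 euclid_norm0 mulr0.
have v_gt0 : 0 < euclid_norm v by rewrite lt_def v_neq0 euclid_norm_ge0.
rewrite -ler_pdivrMr // mulrC -[X in X * _](ger0_norm (x := (euclid_norm v)^-1)).
  rewrite -euclid_normZ scalemxAr; apply: ub_le_sup.
    by case: (has_sup_spectral_norm X).
  exists ((euclid_norm v)^-1 *: v) => //=.
  by rewrite euclid_normZ ger0_norm ?invr_ge0 ?euclid_norm_ge0 // mulVf.
by rewrite invr_ge0 euclid_norm_ge0.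
Qed.

Lemma spectral_norm_le m n (X : 'M[R]_(m, n)) b : 0 <= b ->
  (forall v, euclid_norm (X *m v) <= b * euclid_norm v) -> spectral_norm X <= b.
Proof.
move=> b_ge0 Xb; apply: ge_sup; first by case: (has_sup_spectral_norm X).
by move=> _ [v /= v1 <-]; rewrite (le_trans (Xb v)) // ler_piMr.
Qed.

Lemma spectral_normD m n (X Y : 'M[R]_(m, n)) :
  spectral_norm (X + Y) <= spectral_norm X + spectral_norm Y.
Proof.
apply: spectral_norm_le => [|v]; first by rewrite addr_ge0 ?spectral_norm_ge0.
rewrite mulmxDl mulrDl (le_trans (euclid_normD _ _)) //.
by rewrite lerD ?euclid_norm_mulmx.
Qed.

Lemma spectral_normM m n p (X : 'M[R]_(m, n)) (Y : 'M[R]_(n, p)) :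
  spectral_norm (X *m Y) <= spectral_norm X * spectral_norm Y.
Proof.
apply: spectral_norm_le => [|v]; first by rewrite mulr_ge0 ?spectral_norm_ge0.
rewrite -mulmxA (le_trans (euclid_norm_mulmx _ _)) // -mulrA.
by rewrite ler_wpM2l ?spectral_norm_ge0 ?euclid_norm_mulmx.
Qed.

Lemma spectral_normM_le m n p (X : 'M[R]_(m, n)) (Y : 'M[R]_(n, p)) a b :
  spectral_norm X <= a -> spectral_norm Y <= b -> spectral_norm (X *m Y) <= a * b.
Proof.
move=> Xa Yb; apply: le_trans (spectral_normM _ _) _.
by rewrite ler_pM ?spectral_norm_ge0.
Qed.

Lemma spectral_normN m n (X : 'M[R]_(m, n)) : spectral_norm (- X) = spectral_norm X.
Proof.
rewrite /spectral_norm; congr sup; apply: eq_imagel => v _.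
by rewrite mulNmx euclid_normN.
Qed.

Lemma spectral_normB m n (X Y : 'M[R]_(m, n)) :
  spectral_norm (X - Y) <= spectral_norm X + spectral_norm Y.
Proof. by rewrite -(spectral_normN Y) spectral_normD. Qed.

(** By Cauchy-Schwarz |Y^T v|^2 = v^T (Y (Y^T v)) <= |v| |Y| |Y^T v|; dividing by |Y^T v| gives one
    inequality, and transposing gives the other. *)
Lemma spectral_norm_tr m n (X : 'M[R]_(m, n)) : spectral_norm X^T = spectral_norm X.
Proof.
suff le_tr p q (Y : 'M[R]_(p, q)) : spectral_norm Y^T <= spectral_norm Y.
  by apply/eqP; rewrite eq_le le_tr -{1}(trmxK X) le_tr.
apply: spectral_norm_le => [|v]; first exact: spectral_norm_ge0.
have [->|Yv_neq0] := eqVneq (euclid_norm (Y^T *m v)) 0.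
  by rewrite mulr_ge0 ?spectral_norm_ge0 ?euclid_norm_ge0.
have Yv_gt0 : 0 < euclid_norm (Y^T *m v) by rewrite lt_def Yv_neq0 euclid_norm_ge0.
rewrite -(ler_pM2r Yv_gt0) -expr2 sqr_euclid_normE trmx_mul trmxK -mulmxA.
rewrite (le_trans (dotmx_le _ _)) // mulrAC [leRHS]mulrC.
by rewrite ler_wpM2l ?euclid_norm_ge0 ?euclid_norm_mulmx.
Qed.

(** The hypothesis says in one equation that [K] is symmetric and idempotent. It gives |K v|^2 = v^T
    K v <= |v| |K v|. *)
Lemma spectral_norm_proj_le1 n (K : 'M[R]_n) : K^T *m K = K -> spectral_norm K <= 1.
Proof.
move=> KK; apply: spectral_norm_le => // v; rewrite mul1r.
have [->|Kv_neq0] := eqVneq (euclid_norm (K *m v)) 0; first exact: euclid_norm_ge0.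
have Kv_gt0 : 0 < euclid_norm (K *m v) by rewrite lt_def Kv_neq0 euclid_norm_ge0.
rewrite -(ler_pM2r Kv_gt0) -expr2 sqr_euclid_normE trmx_mul -mulmxA.
by rewrite (mulmxA K^T) KK dotmx_le.
Qed.

Lemma spectral_norm_isom_compl m k (U : 'M[R]_(m, k)) : U^T *m U = 1%:M ->
  spectral_norm (1%:M - U *m U^T) <= 1.
Proof.
move=> UU; apply: spectral_norm_proj_le1.
rewrite [(_ - _)^T]linearB /= trmx1 trmx_mul trmxK mulmxBl mul1mx mulmxBr mulmx1.
by rewrite mulmxA -(mulmxA U) UU mulmx1 subrr subr0.
Qed.

Lemma euclid_norm_isom m k (U : 'M[R]_(m, k)) v : U^T *m U = 1%:M ->
  euclid_norm (U *m v) = euclid_norm v.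
Proof.
move=> UU; apply/eqP; rewrite -(eqrXn2 (ltn0Sn 1)) ?euclid_norm_ge0 //.
by rewrite !sqr_euclid_normE trmx_mul -mulmxA (mulmxA U^T) UU mul1mx.
Qed.

Lemma spectral_norm_isom m k (U : 'M[R]_(m, k)) : U^T *m U = 1%:M ->
  spectral_norm U <= 1.
Proof.
by move=> UU; apply: spectral_norm_le => // v; rewrite euclid_norm_isom // mul1r.
Qed.

Lemma spectral_norm_diag k (d : 'rV[R]_k) b : 0 <= b ->
  (forall i, `|d 0 i| <= b) -> spectral_norm (diag_mx d) <= b.
Proof.
move=> b_ge0 db; apply: spectral_norm_le => // v.
rewrite -ler_sqr ?nnegrE ?mulr_ge0 ?euclid_norm_ge0 // exprMn !sqr_euclid_norm.
rewrite mulr_sumr ler_sum // => i _; rewrite mul_diag_mx mxE exprMn.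
by rewrite ler_wpM2r ?sqr_ge0 // -(real_normK (num_real (d 0 i))) lerXn2r ?nnegrE.
Qed.

(** The lower bound on [d] is asked only on the support of [v], so that Weyl's inequality can apply
    it to vectors supported on the leading coordinates. *)
Lemma ler_euclid_norm_diag k (d : 'rV[R]_k) b (v : 'cV[R]_k) : 0 <= b ->
  (forall i, v i 0 != 0 -> b <= d 0 i) ->
  b * euclid_norm v <= euclid_norm (diag_mx d *m v).
Proof.
move=> b_ge0 bd; rewrite -ler_sqr ?nnegrE ?mulr_ge0 ?euclid_norm_ge0 //.
rewrite exprMn !sqr_euclid_norm mulr_sumr ler_sum // => i _.
rewrite mul_diag_mx mxE exprMn; have [->|/bd bdi] := eqVneq (v i 0) 0.
  by rewrite expr0n !mulr0.
by rewrite ler_wpM2r ?sqr_ge0 // lerXn2r ?nnegrE // (le_trans b_ge0).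
Qed.

Lemma spectral_norm_svd m n k (U : 'M[R]_(m, k)) (d : 'rV[R]_k) (V : 'M[R]_(n, k)) b :
  U^T *m U = 1%:M -> V^T *m V = 1%:M -> 0 <= b -> (forall i, `|d 0 i| <= b) ->
  spectral_norm (U *m diag_mx d *m V^T) <= b.
Proof.
move=> UU VV b_ge0 db; rewrite -[b]mulr1 -[b]mul1r.
apply: spectral_normM_le; last by rewrite spectral_norm_tr spectral_norm_isom.
by apply: spectral_normM_le; [exact: spectral_norm_isom | exact: spectral_norm_diag].
Qed.

Lemma mxrank_inj m n (A : 'M[R]_(m, n)) :
  (forall v : 'cV[R]_n, A *m v = 0 -> v = 0) -> \rank A = n.
Proof.
move=> injA; rewrite -mxrank_tr; apply/eqP/inj_row_free => v vA.
apply: trmx_inj; rewrite trmx0; apply: injA.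
by apply: trmx_inj; rewrite trmx_mul trmxK trmx0.
Qed.

End SpectralNorm.

(** * Pseudoinverses and compact SVDs *)

Section CompactSVD.
Context {R : realType}.
Implicit Types m n k r : nat.

(** [X *m Y] and [X *m Y'] are orthogonal projectors with the same range, hence equal; likewise
    [Y *m X] and [Y' *m X]. Then Y = Y X Y = Y' X Y' = Y'. *)
Lemma penrose_uniq m n (X : 'M[R]_(m, n)) Y Y' :
  penrose X Y -> penrose X Y' -> Y = Y'.
Proof.
move=> [XYX YXY XYs YXs] [XYX' YXY' XYs' YXs'].
have XY : X *m Y = X *m Y'.
  have h : X *m Y = X *m Y' *m (X *m Y) by rewrite mulmxA XYX'.
  by rewrite -XYs h trmx_mul XYs XYs' mulmxA XYX.
have YX : Y *m X = Y' *m X.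
  have h : Y *m X = Y *m X *m (Y' *m X) by rewrite -!mulmxA (mulmxA X) XYX'.
  by rewrite -YXs h trmx_mul YXs YXs' -!mulmxA (mulmxA X) XYX.
by rewrite -YXY YX -mulmxA XY mulmxA YXY'.
Qed.

Lemma pinv_eq m n (X : 'M[R]_(m, n)) Y : penrose X Y -> Defs.pinv X = Y.
Proof.
move=> XY; apply: (@penrose_uniq _ _ X) => //.
by rewrite /Defs.pinv; case: xgetP => [_ -> //|/(_ Y)].
Qed.

Lemma penrose_tr m n (X : 'M[R]_(m, n)) Y : penrose X Y -> penrose X^T Y^T.
Proof.
move=> [XYX YXY XYs YXs]; split; rewrite -?trmx_mul ?mulmxA ?XYX ?YXY //.
- by rewrite YXs.
- by rewrite XYs.
Qed.

(** Full column rank makes the Gram matrix A^T A invertible, since A^T A v = 0 forces |A v|^2 = 0.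
    The inverse Gram matrix times A^T then satisfies the Penrose equations. *)
Lemma penrose_row_full m n (A : 'M[R]_(m, n)) : \rank A = n ->
  penrose A (Defs.pinv A) /\ Defs.pinv A *m A = 1%:M.
Proof.
move=> rkA; have AAu : A^T *m A \in unitmx.
  rewrite -row_free_unit /row_free; apply/eqP/mxrank_inj => v AAv.
  have Av : A *m v = 0.
    apply: euclid_norm_eq0; apply/eqP; rewrite -sqrf_eq0 sqr_euclid_normE.
    by rewrite trmx_mul -mulmxA (mulmxA A^T) AAv mulmx0 mxE.
  apply: trmx_inj; apply: (@row_free_inj _ _ _ _ A^T).
    by rewrite /row_free mxrank_tr rkA.
  by rewrite -trmx_mul Av !trmx0 mul0mx.
have AVA : invmx (A^T *m A) *m A^T *m A = 1%:M by rewrite -mulmxA mulVmx.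
have pA : penrose A (invmx (A^T *m A) *m A^T).
  split; rewrite ?AVA ?mul1mx ?trmx1 // -?(mulmxA A) ?AVA ?mulmx1 //.
  by rewrite trmx_mul trmx_mul trmxK trmx_inv trmx_mul trmxK mulmxA.
by rewrite (pinv_eq pA).
Qed.

Lemma penrose_row_free m n (A : 'M[R]_(m, n)) : \rank A = m ->
  penrose A (Defs.pinv A) /\ A *m Defs.pinv A = 1%:M.
Proof.
rewrite -mxrank_tr => /penrose_row_full [/penrose_tr + AA]; rewrite trmxK => pA.
by rewrite (pinv_eq pA); split=> //; apply: trmx_inj; rewrite trmx_mul trmxK trmx1.
Qed.

Lemma mulmx_diag_inv k (d : 'rV[R]_k) : (forall i, 0 < d 0 i) ->
  diag_mx d *m diag_mx (\row_i (d 0 i)^-1) = 1%:M.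
Proof.
move=> d_gt0; apply/matrixP => i j; rewrite mul_diag_mx !mxE.
by case: eqP => [->|_]; rewrite ?mulr0 // mulfV // gt_eqF.
Qed.

Section OneMatrix.
Variables (m n k : nat) (X : 'M[R]_(m, n)).
Variables (U : 'M[R]_(m, k)) (d : 'rV[R]_k) (V : 'M[R]_(n, k)).
Hypothesis svdX : compact_svd X U d V.

(** The invertible [diag_mx d] equals U^T X V. This is what identifies the sizes of SVDs obtained
    from existential statements. *)
Lemma compact_svd_rank : \rank X = k.
Proof.
case: svdX => UU VV _ d_gt0 XE; apply/eqP; rewrite eqn_leq; apply/andP; split.
  by rewrite XE -mulmxA (leq_trans (mxrankM_maxl _ _)) // rank_leq_col.
have dE : diag_mx d = U^T *m X *m V.
  by rewrite XE !mulmxA UU mul1mx -mulmxA VV mulmx1.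
have rkd : \rank (diag_mx d) = k.
  by apply: mxrank_unit; case: (mulmx1_unit (mulmx_diag_inv d_gt0)).
by rewrite -[leqLHS]rkd dE (leq_trans (mxrankM_maxl _ _)) // mxrankM_maxr.
Qed.

(** The pseudoinverse written with the factors of a given SVD, from which its norm and its products
    with [X] are read off. *)
Definition svd_pinv := V *m diag_mx (\row_i (d 0 i)^-1) *m U^T.

Lemma mulmx_svd_pinv : X *m svd_pinv = U *m U^T.
Proof.
case: svdX => UU VV _ d_gt0 ->; rewrite /svd_pinv !mulmxA.
by rewrite -(mulmxA _ V^T) VV mulmx1 -(mulmxA U) mulmx_diag_inv // mulmx1.
Qed.

Lemma mulmx_svd_pinvl : svd_pinv *m X = V *m V^T.
Proof.
case: svdX => UU VV _ d_gt0 ->; rewrite /svd_pinv !mulmxA.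
rewrite -(mulmxA _ U^T) UU mulmx1 -(mulmxA V) (mulmx1C (mulmx_diag_inv d_gt0)).
by rewrite mulmx1.
Qed.

Lemma mulmx_svd_projl : U *m U^T *m X = X.
Proof. by case: svdX => UU _ _ _ ->; rewrite !mulmxA -(mulmxA U) UU mulmx1. Qed.

Lemma mulmx_svd_projr : X *m (V *m V^T) = X.
Proof.
by case: svdX => _ VV _ _ ->; rewrite !mulmxA -(mulmxA _ V^T V) VV mulmx1.
Qed.

Lemma penrose_svd_pinv : penrose X svd_pinv.
Proof.
split; rewrite ?mulmx_svd_pinv ?mulmx_svd_pinvl ?mulmx_svd_projl //.
- by case: svdX => _ VV _ _ _; rewrite /svd_pinv !mulmxA -(mulmxA V) VV mulmx1.
- by rewrite trmx_mul trmxK.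
- by rewrite trmx_mul trmxK.
Qed.

Lemma spectral_norm_svd_pinv b : 0 < b -> (forall i, b <= d 0 i) ->
  spectral_norm svd_pinv <= b^-1.
Proof.
move=> b_gt0 bd; case: svdX => UU VV _ d_gt0 _.
apply: spectral_norm_svd; rewrite ?invr_ge0 ?(ltW b_gt0) // => i.
by rewrite mxE ger0_norm ?invr_ge0 ?(ltW (d_gt0 i)) // lef_pV2 ?posrE.
Qed.

Lemma ler_euclid_norm_svd b (v : 'cV[R]_n) : 0 <= b -> (forall i, b <= d 0 i) ->
  b * euclid_norm (V^T *m v) <= euclid_norm (X *m v).
Proof.
move=> b_ge0 bd; case: svdX => UU VV _ d_gt0 ->.
by rewrite -!mulmxA (euclid_norm_isom _ UU) ler_euclid_norm_diag.
Qed.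

(* Weyl's inequality, in the case of a matrix [W] whose [i]-th singular value
   vanishes: some nonzero vector of the span of the first [i.+1] right singular
   vectors of [X] is annihilated by [W]. *)
Lemma singular_value_le_dist (W : 'M[R]_(m, n)) (i : 'I_k) : (\rank W <= i)%N ->
  d 0 i <= spectral_norm (X - W).
Proof.
move=> rkW; case: svdX => UU VV d_sorted d_gt0 XE.
rewrite leNgt; apply/negP => lt_di.
(* [J] embeds the first i + 1 coordinates. Indices start at 0, so their number exceeds the bound [i]
   on the rank of [W]. *)
pose J := colsub (widen_ord (ltn_ord i)) (1%:M : 'M[R]_k).
have JJ : J^T *m J = 1%:M.
  apply/matrixP => p q; rewrite !mxE (bigD1 (widen_ord (ltn_ord i) p)) //= big1.
    by rewrite !mxE eqxx mul1r addr0.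
  by move=> x /negPf xp; rewrite !mxE xp mul0r.
have Jsupp (a : 'cV_i.+1) x : (J *m a) x 0 != 0 -> (x <= i)%N.
  apply: contraNT; rewrite -ltnNge => lt_ix; rewrite mxE big1 // => q _.
  rewrite !mxE; case: eqP => [xq|_]; last by rewrite mul0r.
  by move: lt_ix; rewrite xq /= ltnNge -ltnS ltn_ord.
(* If W V J were injective, its rank i + 1 would exceed that of [W]. The remaining goal is this
   injectivity, which follows from the assumed [lt_di]. *)
have := mxrankM_maxl W (V *m J); rewrite mxrank_inj.
  by move=> /leq_trans /(_ rkW); rewrite ltnn.
move=> a Wa; apply: euclid_norm_eq0; apply/eqP; rewrite -(euclid_norm_isom _ JJ).
rewrite -(euclid_norm_isom (J *m a) VV) eq_le euclid_norm_ge0 andbT.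
set v := V *m (J *m a).
have Wv : W *m v = 0 by rewrite /v !mulmxA in Wa *.
have := euclid_norm_mulmx (X - W) v; rewrite mulmxBl Wv subr0.
have : d 0 i * euclid_norm v <= euclid_norm (X *m v).
  rewrite XE /v -!mulmxA (mulmxA V^T) VV mul1mx (euclid_norm_isom _ UU).
  rewrite (euclid_norm_isom _ VV) ler_euclid_norm_diag ?(ltW (d_gt0 i)) //.
  by move=> x /Jsupp xi; exact: d_sorted.
move=> /le_trans h /h; rewrite -subr_ge0 -mulrBl nmulr_rge0 // subr_lt0 //.
Qed.

End OneMatrix.
End CompactSVD.

(** * Singular values and rank truncation under perturbation *)

Section Perturbation.
Context {R : realType}.
Implicit Types m n k r : nat.

Lemma euclid_norm_delta k (i : 'I_k) : euclid_norm (delta_mx i 0 : 'cV[R]_k) = 1.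
Proof.
apply/eqP; rewrite -(eqrXn2 (ltn0Sn 1)) ?euclid_norm_ge0 // expr1n.
rewrite sqr_euclid_normE trmx_delta mul_delta_mx_cond eqxx mulr1n.
by rewrite mxE !eqxx.
Qed.

Lemma diag_mx_delta k (d : 'rV[R]_k) i :
  diag_mx d *m delta_mx i (0 : 'I_1) = d 0 i *: delta_mx i 0.
Proof.
by apply/colP => j; rewrite mul_diag_mx !mxE; case: eqP => [->|]; rewrite ?mulr0.
Qed.

(** [singular_value] is read off an SVD picked by [xget]. The given SVD shows that one exists, and
    the rank forces the picked one to have size [k], so the value is its last and smallest entry. *)
Lemma singular_value_last m n k (X : 'M[R]_(m, n)) U d V :
  (0 < k)%N -> @compact_svd R m n k X U d V ->
  exists U' d' V', [/\ @compact_svd R m n k X U' d' V',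
    0 < singular_value k X & forall i, singular_value k X <= d' 0 i].
Proof.
move=> k_gt0 svdX; have rkX := compact_svd_rank svdX.
rewrite /singular_value; case: xgetP; last first.
  by move=> /(_ [seq d 0 i | i : 'I_k]`_k.-1) []; exists k, U, d, V.
move=> _ -> [k' [U' [d' [V' [svdX' ->]]]]].
have kk' : k' = k by rewrite -(compact_svd_rank svdX').
subst k'; have lt_k : (k.-1 < k)%N by rewrite prednK.
rewrite (nth_map (Ordinal lt_k)) ?size_enum_ord //.
rewrite (nth_ord_enum _ (Ordinal lt_k)).
case: (svdX') => _ _ d_sorted d_gt0 _; exists U', d', V'; split=> // i.
by apply: d_sorted; rewrite /= -ltnS prednK.
Qed.

(** Transfers the bound from the picked SVD to an arbitrary one. Both have the same right projector,
    by uniqueness of the pseudoinverse, so the picked SVD bounds |X v| below by [s] at each unit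
    right singular vector v of the other one, where |X v| is the entry of [d]. *)
Lemma singular_value_le m n k (X : 'M[R]_(m, n)) U d V :
  @compact_svd R m n k X U d V -> forall i, singular_value k X <= d 0 i.
Proof.
move=> svdX i; have k_gt0 : (0 < k)%N by apply: leq_ltn_trans (ltn_ord i).
have [U' [d' [V' [svdX' s_gt0 s_le]]]] := singular_value_last k_gt0 svdX.
set s := singular_value k X in s_gt0 s_le *.
case: (svdX) => UU VV _ d_gt0 XE; case: (svdX') => UU' VV' _ _ XE'.
pose e : 'cV[R]_k := delta_mx i 0.
have e1 : euclid_norm e = 1 by exact: euclid_norm_delta.
have dV : diag_mx d *m e = d 0 i *: e by exact: diag_mx_delta.
have VVE : V' *m V'^T = V *m V^T.
  rewrite -(mulmx_svd_pinvl svdX) -(mulmx_svd_pinvl svdX').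
  by rewrite (penrose_uniq (penrose_svd_pinv svdX) (penrose_svd_pinv svdX')).
have := ler_euclid_norm_svd svdX' (V *m e) (ltW s_gt0) s_le.
rewrite -(euclid_norm_isom _ VV') mulmxA VVE -mulmxA (mulmxA V^T) VV mul1mx.
rewrite (euclid_norm_isom _ VV) e1 mulr1 {1}XE -!mulmxA (mulmxA V^T) VV mul1mx dV.
by rewrite (euclid_norm_isom _ UU) euclid_normZ e1 mulr1 ger0_norm // ltW.
Qed.

(** [W] stretches the vectors [Z *m a] by a factor at least [s], and passing from [W] to [X] loses
    at most the norm of the difference. *)
Lemma ler_euclid_norm_near m n k (W X : 'M[R]_(m, n)) Q l Z s (a : 'cV[R]_k) :
  @compact_svd R m n k W Q l Z -> 0 <= s -> (forall i, s <= l 0 i) ->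
  (s - spectral_norm (X - W)) * euclid_norm a <= euclid_norm (X *m (Z *m a)).
Proof.
move=> svdW s_ge0 s_le; case: (svdW) => _ ZZ _ _ _.
have := ler_euclid_norm_svd svdW (Z *m a) s_ge0 s_le.
have := euclid_norm_mulmx (X - W) (Z *m a).
rewrite (mulmxA Z^T) ZZ mul1mx (euclid_norm_isom _ ZZ) mulrBl lerBlDr.
have -> : W *m (Z *m a) = X *m (Z *m a) - (X - W) *m (Z *m a).
  by rewrite mulmxBl opprB addrC subrK.
move: ((X - W) *m _) => u; move=> le1 /le_trans; apply.
by rewrite (le_trans (euclid_normD _ _)) // euclid_normN lerD2l.
Qed.

(** Turns the truncation relation into usable data: an SVD of [Y] of size exactly [r], a positive
    lower bound on its singular values, and a residual carried by the discarded singular vectors. *)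
Lemma svd_truncation_near m n r (W X Y : 'M[R]_(m, n)) Q l Z s :
  @compact_svd R m n r W Q l Z -> (forall i, s <= l 0 i) ->
  2 * spectral_norm (X - W) < s -> svd_truncation r X Y ->
  exists U d V, [/\ @compact_svd R m n r Y U d V,
    forall i, s - 2 * spectral_norm (X - W) <= d 0 i,
    U^T *m (X - Y) = 0, (X - Y) *m V = 0
    & spectral_norm (X - Y) <= spectral_norm (X - W)].
Proof.
set e := spectral_norm (X - W) => svdW s_le es.
have e_ge0 : 0 <= e by exact: spectral_norm_ge0.
have s_ge0 : 0 <= s by lra.
move=> [k [U [d [V [svdX YE]]]]].
(* [X] is injective on the range of [Z], of dimension [r], because s - e > 0; so the truncation
   really keeps [r] terms. *)
have le_rk : (r <= k)%N.
  rewrite -(compact_svd_rank svdX) (leq_trans _ (mxrankM_maxl X Z)) //.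
  rewrite mxrank_inj // => a XZa.
  have := ler_euclid_norm_near X a svdW s_ge0 s_le; rewrite mulmxA XZa euclid_norm0.
  rewrite pmulr_rle0 ?subr_gt0; last by rewrite -/e; lra.
  by move=> a0; apply: euclid_norm_eq0; apply/eqP; rewrite eq_le a0 euclid_norm_ge0.
have [k2 kE] : exists k2, k = (r + k2)%N by exists (k - r)%N; rewrite subnKC.
subst k; case: (svdX) => UU VV d_sorted d_gt0 XE.
pose U1 := lsubmx U; pose V1 := lsubmx V; pose d1 := lsubmx d.
pose U2 := rsubmx U; pose V2 := rsubmx V; pose d2 := rsubmx d.
have isom_blocks p (T : 'M[R]_(p, r + k2)) : T^T *m T = 1%:M ->
    [/\ (lsubmx T)^T *m lsubmx T = 1%:M, (lsubmx T)^T *m rsubmx T = 0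
    , (rsubmx T)^T *m lsubmx T = 0 & (rsubmx T)^T *m rsubmx T = 1%:M].
  rewrite -{1 2}[T]hsubmxK tr_row_mx mul_col_row scalar_mx_block.
  by move=> /eq_block_mx [].
have [U11 U12 _ U22] := isom_blocks _ _ UU.
have [V11 _ V21 V22] := isom_blocks _ _ VV.
have XE' : X = U1 *m diag_mx d1 *m V1^T + U2 *m diag_mx d2 *m V2^T.
  rewrite {1}XE -{1}[U]hsubmxK -{1}[d]hsubmxK -{1}[V]hsubmxK diag_mx_row tr_row_mx.
  by rewrite mul_row_block !mulmx0 addr0 add0r mul_row_col.
have {}YE : Y = U1 *m diag_mx d1 *m V1^T.
  rewrite YE; set d0 := \row_i _.
  have -> : d0 = row_mx d1 0.
    apply/rowP => i; rewrite mxE; case: (split_ordP i) => j -> /=.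
      by rewrite row_mxEl mxE.
    by rewrite row_mxEr mxE.
  rewrite -{1}[U]hsubmxK -{1}[V]hsubmxK diag_mx_row tr_row_mx linear0.
  by rewrite mul_row_block !mulmx0 !addr0 mul_row_col mul0mx addr0.
have NE : X - Y = U2 *m diag_mx d2 *m V2^T by rewrite XE' YE addrC addKr.
(* The entries of [d2] have index at least [r], counted from 0, and [W] has rank [r], so Weyl's
   inequality bounds each of them by [e]. *)
have Ne : spectral_norm (X - Y) <= e.
  rewrite NE; apply: spectral_norm_svd => // i.
  rewrite mxE ger0_norm ?(ltW (d_gt0 _)) //.
  by apply: (singular_value_le_dist svdX); rewrite (compact_svd_rank svdW) leq_addr.
have YW : spectral_norm (Y - W) <= 2 * e.
  have -> : Y - W = (X - W) - (X - Y) by rewrite opprB [RHS]addrC addrA subrK.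
  by rewrite (le_trans (spectral_normB _ _)) // mulr2n mulrDl mul1r lerD2l.
have svdY : compact_svd Y U1 d1 V1.
  by split=> // [i j ij|i]; rewrite !mxE // d_sorted.
exists U1, d1, V1; split=> //; last first.
- by rewrite NE -mulmxA V21 mulmx0.
- by rewrite NE !mulmxA U12 !mul0mx.
(* The singular values of [Y] are bounded below through the range of [Z], on which [Y] inherits a
   lower bound from [W]. *)
have Yge a : (s - 2 * e) * euclid_norm a <= euclid_norm (Y *m (Z *m a)).
  apply: le_trans (ler_euclid_norm_near Y a svdW s_ge0 s_le).
  by rewrite ler_wpM2r ?euclid_norm_ge0 // lerB.
have V1Z_unit : V1^T *m Z \in unitmx.
  rewrite -row_free_unit /row_free; apply/eqP/mxrank_inj => a V1Za.
  have := Yge a; rewrite YE -!mulmxA (mulmxA V1^T) V1Za !mulmx0 euclid_norm0.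
  rewrite pmulr_rle0 ?subr_gt0 // => a0.
  by apply: euclid_norm_eq0; apply/eqP; rewrite eq_le a0 euclid_norm_ge0.
(* This [a] makes [Z *m a] see only the [i]-th singular direction of [Y]: |Y Z a| is then the [i]-th
   singular value, while |a| >= |V1^T Z a| = 1. *)
move=> i; pose a : 'cV[R]_r := invmx (V1^T *m Z) *m delta_mx i 0.
have V1Za : V1^T *m (Z *m a) = delta_mx i 0 by rewrite /a !mulmxA mulmxV // mul1mx.
have a_ge1 : 1 <= euclid_norm a.
  case: (svdW) => _ ZZ _ _ _; rewrite -(euclid_norm_delta i) -V1Za.
  rewrite (le_trans (euclid_norm_mulmx _ _)) // spectral_norm_tr.
  rewrite (euclid_norm_isom _ ZZ) -[leRHS]mul1r.
  by rewrite ler_wpM2r ?euclid_norm_ge0 ?spectral_norm_isom.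
rewrite -[leLHS]mulr1 (le_trans _ (le_trans (Yge a) _)) //.
  by rewrite ler_wpM2l // subr_ge0 ltW.
rewrite YE -!mulmxA V1Za diag_mx_delta -scalemxAr euclid_normZ (euclid_norm_isom _ U11).
by rewrite euclid_norm_delta mulr1 ger0_norm // mxE ltW.
Qed.

End Perturbation.

(** * Expansion of the truncation and estimates for its pseudoinverse *)

Section Expansion.
Context {R : realType}.
Implicit Types m n k r : nat.

Lemma compact_svd_tr m n k (X : 'M[R]_(m, n)) U d V :
  @compact_svd R m n k X U d V -> compact_svd X^T V d U.
Proof.
move=> [UU VV d_sorted d_gt0 ->]; split=> //.
by rewrite !trmx_mul trmxK tr_diag_mx mulmxA.
Qed.

Lemma svd_pinv_tr m n k (U : 'M[R]_(m, k)) d (V : 'M[R]_(n, k)) :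
  svd_pinv V d U = (svd_pinv U d V)^T.
Proof. by rewrite /svd_pinv !trmx_mul trmxK tr_diag_mx mulmxA. Qed.

(** Write p - p' as (1-p') p minus the transpose of (1-p) p'. Since p = X X^+ and (1-p') Y = 0, the
    first product is (1-p') (X-Y) X^+, and the second is treated symmetrically. *)
Lemma svd_proj_near m n k k' (X Y : 'M[R]_(m, n)) U d V U' d' V' :
  @compact_svd R m n k X U d V -> @compact_svd R m n k' Y U' d' V' ->
  spectral_norm (U *m U^T - U' *m U'^T) <=
    spectral_norm (X - Y)
    * (spectral_norm (svd_pinv U d V) + spectral_norm (svd_pinv U' d' V')).
Proof.
move=> svdX svdY; case: (svdX) => UU _ _ _ _; case: (svdY) => UU' _ _ _ _.
set p := U *m U^T; set p' := U' *m U'^T.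
set Xp := svd_pinv U d V; set Yp := svd_pinv U' d' V'.
have pE : (1%:M - p') *m p = (1%:M - p') *m (X - Y) *m Xp.
  rewrite /p -(mulmx_svd_pinv svdX) mulmxBr mulmxA.
  by rewrite (mulmxBl 1%:M p' Y) mul1mx (mulmx_svd_projl svdY) subrr subr0.
have p'E : (1%:M - p) *m p' = - ((1%:M - p) *m (X - Y) *m Yp).
  rewrite /p' -(mulmx_svd_pinv svdY) mulmxBr mulmxA.
  by rewrite (mulmxBl 1%:M p X) mul1mx (mulmx_svd_projl svdX) subrr add0r mulNmx opprK.
have -> : p - p' = ((1%:M - p') *m p) - ((1%:M - p) *m p')^T.
  rewrite trmx_mul [(1%:M - p)^T]linearB /= trmx1 !trmx_mul !trmxK -/p -/p'.
  by rewrite mulmxBl mulmxBr mulmx1 mul1mx opprB addrA subrK.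
rewrite (le_trans (spectral_normB _ _)) // spectral_norm_tr pE p'E spectral_normN.
rewrite mulrDr lerD // -[X in _ <= X * _]mul1r; apply: spectral_normM_le => //;
  by apply: spectral_normM_le => //; exact: spectral_norm_isom_compl.
Qed.

(** Splits off the normal component (1-q) G (1-z) of [G]; what is subtracted is the tangential part
    of [N]. *)
Lemma tangent_proj_compl m n r (Q : 'M[R]_(m, r)) (Z : 'M[R]_(n, r))
    (G N : 'M[R]_(m, n)) :
  let q := Q *m Q^T in let z := Z *m Z^T in
  G - tangent_proj Q Z (G + N) =
  (1%:M - q) *m G *m (1%:M - z) - (q *m N + (1%:M - q) *m (N *m z)).
Proof.
rewrite /tangent_proj /=; move: (Q *m Q^T) (Z *m Z^T) => q z.
rewrite !(mulmxDl, mulmxDr, mul1mx, mulmx1, mulNmx, mulmxN) !mulmxA.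
move: (q *m G) (q *m N) (G *m z) (N *m z) (q *m G *m z) (q *m N *m z).
by move=> *; apply/matrixP => i j; rewrite !mxE; ring.
Qed.

Section Truncation.
Variables (m n r : nat) (W X Y : 'M[R]_(m, n)) (s : R).
Variables (Q : 'M[R]_(m, r)) (l : 'rV[R]_r) (Z : 'M[R]_(n, r)).
Hypotheses (svdW : compact_svd W Q l Z) (s_le : forall i, s <= l 0 i).
Hypotheses (near : 2 * spectral_norm (X - W) < s) (truncY : svd_truncation r X Y).

Let e := spectral_norm (X - W).

Lemma truncation_dist : spectral_norm (Y - W) <= 2 * e.
Proof.
have [U [d [V [svdY d_ge UN NV Ne]]]] := svd_truncation_near svdW s_le near truncY.
have -> : Y - W = (X - W) - (X - Y) by rewrite opprB [RHS]addrC addrA subrK.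
by rewrite (le_trans (spectral_normB _ _)) // mulr2n mulrDl mul1r lerD2l.
Qed.

(** The first summand of the bound collects q N and (1-q) N z, each at most 2 e^2 / s. The second is
    (2 e)^2 / (s - 2 e), from the normal component of [Y - W]. *)
Lemma truncation_expansion :
  spectral_norm (Y - (W + tangent_proj Q Z (X - W)))
    <= 4 * e ^+ 2 / s + 4 * e ^+ 2 / (s - 2 * e).
Proof.
have [U [d [V [svdY d_ge UN NV Ne]]]] := svd_truncation_near svdW s_le near truncY.
have Ge := truncation_dist; have s_gt0 : 0 < s.
  by apply: le_lt_trans near; rewrite mulr_ge0 ?spectral_norm_ge0.
case: (svdW) => QQ ZZ _ _ _.
have Yp_le : spectral_norm (svd_pinv U d V) <= (s - 2 * e)^-1.
  by apply: (spectral_norm_svd_pinv svdY); rewrite ?subr_gt0.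
have Wp_le : spectral_norm (svd_pinv Q l Z) <= s^-1.
  exact: (spectral_norm_svd_pinv svdW).
set Yp := svd_pinv U d V in Yp_le.
set Wp := svd_pinv Q l Z in Wp_le.
set N := X - Y in UN NV Ne; set G := Y - W in Ge.
pose q := Q *m Q^T; pose z := Z *m Z^T.
have YN : Y^T *m N = 0.
  by case: (svdY) => _ _ _ _ ->; rewrite !trmx_mul -!mulmxA UN !mulmx0.
have NY : N *m Y^T = 0.
  by case: (svdY) => _ _ _ _ ->; rewrite !trmx_mul trmxK !mulmxA NV !mul0mx.
have WE : W = Y - G by rewrite opprB addrC subrK.
have qN : q *m N = - (Wp^T *m G^T *m N).
  have -> : q = Wp^T *m W^T.
    by rewrite -trmx_mul (mulmx_svd_pinv svdW) trmx_mul trmxK.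
  rewrite WE [(_ - _)^T]linearB /= -mulmxA mulmxBl YN sub0r mulmxN mulmxA.
  by congr (- (_ *m _ *m _)).
have Nz : N *m z = - (N *m G^T *m Wp^T).
  have -> : z = W^T *m Wp^T.
    by rewrite -trmx_mul (mulmx_svd_pinvl svdW) trmx_mul trmxK.
  by rewrite WE [(_ - _)^T]linearB /= mulmxA mulmxBr NY sub0r mulNmx.
(* Both (1-q) W and W (1-z) vanish, so [G] and [Y] are interchangeable next to these projectors;
   inserting Y = Y Y^+ Y then produces two factors [G]. *)
have perp : (1%:M - q) *m G *m (1%:M - z)
    = (1%:M - q) *m G *m Yp *m (G *m (1%:M - z)).
  have qG : (1%:M - q) *m G = (1%:M - q) *m Y.
    by rewrite mulmxBr (mulmxBl 1%:M q W) mul1mx (mulmx_svd_projl svdW) subrr subr0.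
  have Gz : G *m (1%:M - z) = Y *m (1%:M - z).
    by rewrite mulmxBl (mulmxBr W) mulmx1 (mulmx_svd_projr svdW) subrr subr0.
  rewrite qG Gz -(mulmxA _ Y Yp) (mulmx_svd_pinv svdY) (mulmxA _ Y).
  by rewrite -(mulmxA _ (U *m U^T) Y) (mulmx_svd_projl svdY).
have -> : Y - (W + tangent_proj Q Z (X - W)) =
    (1%:M - q) *m G *m (1%:M - z) - (q *m N + (1%:M - q) *m (N *m z)).
  have -> : X - W = G + N by rewrite /G /N [RHS]addrC addrA subrK.
  by rewrite opprD addrA tangent_proj_compl.
have q_le1 : spectral_norm (1%:M - q) <= 1 by exact: spectral_norm_isom_compl.
have z_le1 : spectral_norm (1%:M - z) <= 1 by exact: spectral_norm_isom_compl.
have perp_le : spectral_norm ((1%:M - q) *m G *m (1%:M - z))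
    <= 1 * (2 * e) * (s - 2 * e)^-1 * (2 * e * 1).
  rewrite perp; exact: spectral_normM_le (spectral_normM_le
    (spectral_normM_le q_le1 Ge) Yp_le) (spectral_normM_le Ge z_le1).
have GT_le : spectral_norm G^T <= 2 * e by rewrite spectral_norm_tr.
have WpT_le : spectral_norm Wp^T <= s^-1 by rewrite spectral_norm_tr.
have qN_le : spectral_norm (q *m N) <= s^-1 * (2 * e) * e.
  rewrite qN spectral_normN.
  exact: spectral_normM_le (spectral_normM_le WpT_le GT_le) Ne.
have Nz_le : spectral_norm ((1%:M - q) *m (N *m z)) <= 1 * (e * (2 * e) * s^-1).
  apply: spectral_normM_le q_le1 _; rewrite Nz spectral_normN.
  exact: spectral_normM_le (spectral_normM_le Ne GT_le) WpT_le.
rewrite (le_trans (spectral_normB _ _)) // addrC.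
apply: le_trans (lerD (le_trans (spectral_normD _ _) (lerD qN_le Nz_le)) perp_le) _.
by rewrite le_eqVlt; apply/orP; left; apply/eqP; ring.
Qed.

(** The condition gives s - 2 e >= s / 2, so both pseudoinverses have norm at most [b]. The constant
    6 is 4 for the distance of the projectors plus 2 for replacing [Y] by [W]; 15 is 2 + 4 from
    [truncation_expansion], 4 + 4 from the two projectors and 1 from D Y^+ D. *)
Lemma pinv_truncation_near : 4 * e <= s ->
  let Yp := Defs.pinv Y in let b := 2 / s in
  [/\ spectral_norm Yp <= b,
      spectral_norm (W *m Yp - Q *m Q^T) <= 6 * b * e,
      spectral_norm (Yp *m W - Z *m Z^T) <= 6 * b * e
    & spectral_norm (W *m Yp *m W - (W - Q *m Q^T *m (X - W) *m (Z *m Z^T)))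
        <= 15 * b * e ^+ 2].
Proof.
move=> e_le Yp b.
have [U [d [V [svdY d_ge UN NV Ne]]]] := svd_truncation_near svdW s_le near truncY.
have Ge := truncation_dist; have Te := truncation_expansion.
have s_gt0 : 0 < s by apply: le_lt_trans near; rewrite mulr_ge0 ?spectral_norm_ge0.
have b_gt0 : 0 < b by rewrite divr_gt0.
have YpE : Yp = svd_pinv U d V by exact: pinv_eq (penrose_svd_pinv svdY).
have YpP := penrose_svd_pinv svdY.
have sb : (s - 2 * e)^-1 <= b.
  by rewrite /b -invf_div lef_pV2 ?posrE ?subr_gt0 ?divr_gt0 //; lra.
have Yp_le : spectral_norm Yp <= b.
  rewrite YpE; apply: le_trans sb.
  by apply: (spectral_norm_svd_pinv svdY); rewrite ?subr_gt0.
have sb' : s^-1 = b / 2 by rewrite /b mulrAC divff // mul1r.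
have Wp_le : spectral_norm (svd_pinv Q l Z) <= b.
  apply: le_trans (_ : s^-1 <= b); first exact: (spectral_norm_svd_pinv svdW).
  by rewrite sb' ler_pdivrMr // ler_peMr ?ltW // ltr1n.
have YYp : Y *m Yp = U *m U^T by rewrite YpE (mulmx_svd_pinv svdY).
have YpY : Yp *m Y = V *m V^T by rewrite YpE (mulmx_svd_pinvl svdY).
have NYp : (X - Y) *m Yp = 0 by rewrite YpE /svd_pinv !mulmxA NV !mul0mx.
have YpN : Yp *m (X - Y) = 0 by rewrite YpE /svd_pinv -!mulmxA UN !mulmx0.
have qU : spectral_norm (Y *m Yp - Q *m Q^T) <= 4 * b * e.
  rewrite YYp; apply: le_trans (svd_proj_near svdY svdW) _; rewrite -YpE.
  apply: le_trans (ler_pM (spectral_norm_ge0 _) _ Ge (lerD Yp_le Wp_le)) _.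
    by rewrite addr_ge0 ?spectral_norm_ge0.
  by rewrite le_eqVlt; apply/orP; left; apply/eqP; ring.
have zV : spectral_norm (Yp *m Y - Z *m Z^T) <= 4 * b * e.
  rewrite YpY.
  apply: le_trans (svd_proj_near (compact_svd_tr svdY) (compact_svd_tr svdW)) _.
  have -> : Y^T - W^T = (Y - W)^T by rewrite [RHS]linearB.
  rewrite (svd_pinv_tr U) (svd_pinv_tr Q) !spectral_norm_tr -YpE.
  apply: le_trans (ler_pM (spectral_norm_ge0 _) _ Ge (lerD Yp_le Wp_le)) _.
    by rewrite addr_ge0 ?spectral_norm_ge0.
  by rewrite le_eqVlt; apply/orP; left; apply/eqP; ring.
rewrite -YpE in YpP.
move: (Yp) NYp YpN Yp_le qU zV YpP {YpE YYp YpY}.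
move=> {}Yp NYp YpN Yp_le qU zV YpP.
set D := X - W; have De : spectral_norm D <= e by [].
have YYpY : Y *m Yp *m Y = Y by case: YpP.
have XYp : X *m Yp = Y *m Yp by apply/eqP; rewrite -subr_eq0 -mulmxBl NYp.
have YpX : Yp *m X = Yp *m Y by apply/eqP; rewrite -subr_eq0 -mulmxBr YpN.
have WE : W = X - D by rewrite opprB addrC subrK.
rewrite -/D in Te *; clearbody D.
split=> //.
- have -> : W *m Yp - Q *m Q^T = (Y *m Yp - Q *m Q^T) - (Y - W) *m Yp.
    by rewrite mulmxBl opprB [RHS]addrC addrA subrK.
  apply: le_trans (spectral_normB _ _) _.
  apply: le_trans (lerD qU (spectral_normM_le Ge Yp_le)) _.
  by rewrite le_eqVlt; apply/orP; left; apply/eqP; ring.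
- have -> : Yp *m W - Z *m Z^T = (Yp *m Y - Z *m Z^T) - Yp *m (Y - W).
    by rewrite mulmxBr opprB [RHS]addrC addrA subrK.
  apply: le_trans (spectral_normB _ _) _.
  apply: le_trans (lerD zV (spectral_normM_le Yp_le Ge)) _.
  by rewrite le_eqVlt; apply/orP; left; apply/eqP; ring.
(* An exact identity: [Yp] kills the residual on both sides, so [X] may be replaced by [Y] next to
   it. *)
- have WYpW : W *m Yp *m W = Y - D *m (Yp *m Y) - Y *m Yp *m D + D *m Yp *m D.
    rewrite WE mulmxBl mulmxBr mulmxBl XYp.
    rewrite -(mulmxA Y Yp X) -(mulmxA D Yp X) YpX (mulmxA Y) YYpY mulmxBl.
    by rewrite opprB addrA addrAC.
  have -> : W *m Yp *m W - (W - Q *m Q^T *m D *m (Z *m Z^T)) =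
      Y - (W + tangent_proj Q Z D) - D *m (Yp *m Y - Z *m Z^T)
      - (Y *m Yp - Q *m Q^T) *m D + D *m Yp *m D.
    rewrite WYpW /tangent_proj mulmxBr mulmxBl.
    move: (Q *m Q^T *m D) (Z *m Z^T) (D *m (Yp *m Y)) (Y *m Yp *m D) (D *m Yp *m D).
    move=> qD z DYpY YYpD DYpD; move: (qD *m z) (D *m z) => qDz Dz.
    by apply/matrixP => i j; rewrite !mxE; ring.
  apply: le_trans (spectral_normD _ _) _.
  apply: le_trans (lerD (spectral_normB _ _)
    (spectral_normM_le (spectral_normM_le De Yp_le) De)) _.
  apply: le_trans (lerD (lerD (le_trans (spectral_normB _ _)
    (lerD Te (spectral_normM_le De zV))) (spectral_normM_le qU De)) (lexx _)) _.
  apply: (@le_trans _ _ (4 * e ^+ 2 * (b / 2) + 4 * e ^+ 2 * b + e * (4 * b * e)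
    + 4 * b * e * e + e * b * e)).
    rewrite !lerD2r sb' lerD2l ler_wpM2l //.
    by rewrite mulr_ge0 ?sqr_ge0.
  by rewrite le_eqVlt; apply/orP; left; apply/eqP; field.
Qed.

End Truncation.
End Expansion.

(** * The CUR map near [M] *)

Section CUR.
Context {R : realType}.
Variables (m n s c r : nat).
Variables (M : 'M[R]_(m, n)) (U : 'M[R]_(m, r)) (d : 'rV[R]_r) (V : 'M[R]_(n, r)).
Variables (S : 'M[R]_(m, s)) (P : 'M[R]_(n, c)).
Hypotheses (svdM : compact_svd M U d V) (admSP : admissible S P U V).

Let W := S^T *m M *m P.
(** Halves of the oblique projectors: the left one is B S^T and the right one is P C. *)
Let B := U *m Defs.pinv (S^T *m U).
Let C := Defs.pinv (V^T *m P) *m V^T.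

(** W = (S^T U) diag(d) (V^T P), and admissibility lets the last two factors be cancelled on the
    right, which recovers S^T U, of rank [r], from [W]. *)
Lemma CUR_sample_rank : \rank W = r.
Proof.
case: admSP => rkSU rkVP; case: svdM => _ _ _ d_gt0 ME.
have [_ SU1] := penrose_row_full rkSU; have [_ VP1] := penrose_row_free rkVP.
have WE : W = S^T *m U *m diag_mx d *m (V^T *m P) by rewrite /W ME !mulmxA.
apply/eqP; rewrite eqn_leq; apply/andP; split.
  by rewrite WE -mulmxA (leq_trans (mxrankM_maxl _ _)) // rank_leq_col.
have SUE : S^T *m U = W *m (Defs.pinv (V^T *m P) *m diag_mx (\row_i (d 0 i)^-1)).
  rewrite WE mulmxA -(mulmxA _ (V^T *m P)) VP1 mulmx1 -mulmxA.
  by rewrite mulmx_diag_inv // mulmx1.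
by rewrite -{1}rkSU SUE mxrankM_maxl.
Qed.

(** By the full ranks of its factors, the pseudoinverse of [W] is the reversed product [Wp] of their
    inverses. Uniqueness identifies it with the one built from the SVD, so the projectors of any SVD
    of [W] are expressed by [B] and [C]. *)
Lemma CUR_sample_svd k (Q : 'M[R]_(s, k)) l (Z : 'M[R]_(c, k)) :
  compact_svd W Q l Z ->
  [/\ Q *m Q^T = S^T *m B, Z *m Z^T = C *m P, B *m W = M *m P & W *m C = S^T *m M].
Proof.
move=> svdW.
case: admSP => rkSU rkVP; case: svdM => _ _ _ d_gt0 ME.
have [pSU SU1] := penrose_row_full rkSU; have [pVP VP1] := penrose_row_free rkVP.
have WE : W = S^T *m U *m diag_mx d *m (V^T *m P) by rewrite /W ME !mulmxA.
have [A AE] : exists A, A = S^T *m U by exists (S^T *m U).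
have [A' AE'] : exists A', A' = V^T *m P by exists (V^T *m P).
rewrite /B /C -AE -AE' in pSU SU1 pVP VP1 WE *.
case: pSU pVP => _ ApA As _ [_ ApA' _ As'].
pose Wp := Defs.pinv A' *m diag_mx (\row_i (d 0 i)^-1) *m Defs.pinv A.
have WWp : W *m Wp = A *m Defs.pinv A.
  rewrite WE /Wp !mulmxA -(mulmxA _ A') VP1 mulmx1 -(mulmxA A (diag_mx _)).
  by rewrite mulmx_diag_inv // mulmx1.
have WpW : Wp *m W = Defs.pinv A' *m A'.
  rewrite WE /Wp !mulmxA -(mulmxA _ (Defs.pinv A)) SU1 mulmx1.
  by rewrite -(mulmxA (Defs.pinv A') (diag_mx _)) (mulmx1C (mulmx_diag_inv d_gt0)) mulmx1.
have WpP : penrose W Wp.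
  split; rewrite ?WWp ?WpW //.
    by rewrite WE !mulmxA -(mulmxA A) SU1 mulmx1.
  by rewrite /Wp !mulmxA ApA'.
have WpE := penrose_uniq WpP (penrose_svd_pinv svdW).
split.
- by rewrite -(mulmx_svd_pinv svdW) -WpE WWp AE mulmxA.
- by rewrite -(mulmx_svd_pinvl svdW) -WpE WpW AE' mulmxA.
- by rewrite WE ME !mulmxA -(mulmxA U) SU1 mulmx1 AE' mulmxA.
- by rewrite WE ME !mulmxA -(mulmxA _ A') VP1 mulmx1 AE.
Qed.

(** An algebraic identity in an arbitrary [Yp], from expanding (B W + E P) Yp (W C + S^T E). Since B
    W C = M, B q = B and z C = C, the subtracted main parts add up to [M] plus the tangent term. *)
Lemma CUR_map_remainder E Yp (q : 'M[R]_s) (z : 'M[R]_c) :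
  q = S^T *m B -> z = C *m P -> B *m W = M *m P -> W *m C = S^T *m M ->
  (M + E) *m P *m Yp *m (S^T *m (M + E)) - M - oblique_tangent_proj S P U V E =
  B *m (W *m Yp *m W - (W - q *m (S^T *m E *m P) *m z)) *m C
  + B *m (W *m Yp - q) *m (S^T *m E) + E *m P *m (Yp *m W - z) *m C
  + E *m P *m Yp *m (S^T *m E).
Proof.
move=> qE zE BW WC.
case: admSP => rkSU rkVP; case: svdM => _ _ _ _ ME.
have [[_ pSU _ _] SU1] := penrose_row_full rkSU.
have [[_ pVP _ _] VP1] := penrose_row_free rkVP.
have BWC : B *m W *m C = M.
  by rewrite BW ME /C !mulmxA -(mulmxA _ V^T P) -(mulmxA _ (V^T *m P)) VP1 mulmx1.
have Bq : B *m q = B by rewrite qE /B -[in RHS]pSU !mulmxA.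
have zC : z *m C = C by rewrite zE /C -[in RHS]pVP !mulmxA.
have -> : oblique_tangent_proj S P U V E =
    B *m (S^T *m E) + E *m P *m C - B *m (S^T *m E *m P) *m C.
  by rewrite /oblique_tangent_proj /oblique_left /oblique_right /B /C !mulmxA.
have -> : (M + E) *m P = B *m W + E *m P by rewrite mulmxDl BW.
have -> : S^T *m (M + E) = W *m C + S^T *m E by rewrite mulmxDr WC.
rewrite -{1}BWC; move: (S^T *m E *m P) (S^T *m E) (E *m P) => D SE EP.
clearbody B W C; clear -Bq zC.
rewrite !(mulmxDl, mulmxDr, mulmxN, mulNmx, opprD, opprK) !mulmxA Bq.
rewrite -(mulmxA _ z C) zC -(mulmxA _ z C) zC.
move: (B *m W *m Yp *m W *m C) (EP *m Yp *m W *m C) (B *m W *m Yp *m SE).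
move: (EP *m Yp *m SE) (B *m W *m C) (B *m SE *m P *m C) (B *m SE) (EP *m C).
by move=> *; apply/matrixP => i j; rewrite !mxE; ring.
Qed.

Lemma CUR_map_expansion trunc : (0 < r)%N ->
  (forall X, svd_truncation r X (trunc X)) ->
  exists K delta : R, [/\ 0 < K, 0 < delta & forall E : 'M[R]_(m, n),
    spectral_norm E <= delta ->
    spectral_norm (CUR_map S P trunc (M + E) - M - oblique_tangent_proj S P U V E)
      <= K * spectral_norm E ^+ 2].
Proof.
move=> r_gt0 truncP.
(* The truncation hypothesis at [W] itself supplies an SVD of [W]. *)
have [k [Q [l [Z [svdW _]]]]] := truncP W.
have kr : k = r by rewrite -(compact_svd_rank svdW) CUR_sample_rank.
subst k; have [QE ZE BW WC] := CUR_sample_svd svdW.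
have [_ [_ [_ [_ w_gt0 _]]]] := singular_value_last r_gt0 svdW.
have w_le := singular_value_le svdW; set w := singular_value r W in w_gt0 w_le.
set a := spectral_norm S^T; set p := spectral_norm P.
set b := spectral_norm B; set g := spectral_norm C; set h := 2 / w.
have [a_ge0 p_ge0] : 0 <= a /\ 0 <= p by rewrite !spectral_norm_ge0.
have [b_ge0 g_ge0] : 0 <= b /\ 0 <= g by rewrite !spectral_norm_ge0.
have h_gt0 : 0 < h by rewrite divr_gt0.
pose t := a * p; have t_ge0 : 0 <= t by exact: mulr_ge0.
(* The four products bound the four terms of the remainder, with |D| <= t |E|; the final 1 makes the
   constant positive. The radius ensures 4 |D| <= w, and t + 1 avoids a division by zero. *)
exists (b * (15 * h * t ^+ 2) * g + b * (6 * h * t) * a + p * (6 * h * t) * g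
        + p * h * a + 1), (w / (4 * (t + 1))).
have t4_gt0 : 0 < 4 * (t + 1) by rewrite mulr_gt0 // ltr_wpDl.
have h_ge0 := ltW h_gt0.
split.
- by rewrite ltr_wpDl // !addr_ge0 // !mulr_ge0 // invr_ge0 ltW.
- by rewrite divr_gt0.
move=> E; set e := spectral_norm E => e_le.
have e_ge0 : 0 <= e by exact: spectral_norm_ge0.
set X := S^T *m (M + E) *m P; set D := S^T *m E *m P.
have XW : X - W = D by rewrite /X mulmxDr mulmxDl addrAC subrr add0r.
have De : spectral_norm D <= t * e.
  rewrite /t mulrAC; exact: spectral_normM_le (spectral_normM_le (lexx _) (lexx _)) (lexx _).
have e4 : 4 * spectral_norm D <= w.
  move: e_le; rewrite ler_pdivlMr // => e_le.
  apply: le_trans e_le; rewrite mulrA [e * 4]mulrC -mulrA ler_pM2l //.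
  by rewrite (le_trans De) // mulrC ler_wpM2l // lerDl.
have near : 2 * spectral_norm (X - W) < w.
  by rewrite XW; have := spectral_norm_ge0 D; move: e4 w_gt0; lra.
have := pinv_truncation_near svdW w_le near (truncP X); rewrite XW => /(_ e4) [].
rewrite -/h; set Yp := Defs.pinv (trunc X) => Yp_le WYp_le YpW_le WYpW_le.
rewrite /CUR_map -/X -/Yp.
rewrite (CUR_map_remainder _ _ QE ZE BW WC) -/D.
have le0 : spectral_norm D ^+ 2 <= (t * e) ^+ 2.
  by rewrite lerXn2r ?nnegrE ?spectral_norm_ge0 ?mulr_ge0.
have T1 : spectral_norm (B *m (W *m Yp *m W
    - (W - Q *m Q^T *m D *m (Z *m Z^T))) *m C) <= b * (15 * h * (t * e) ^+ 2) * g.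
  apply: spectral_normM_le (lexx _); apply: spectral_normM_le (lexx _) _.
  by rewrite (le_trans WYpW_le) // ler_wpM2l // mulr_ge0.
have h6 : 6 * h * spectral_norm D <= 6 * h * (t * e) by rewrite ler_wpM2l // mulr_ge0.
have T2 : spectral_norm (B *m (W *m Yp - Q *m Q^T) *m (S^T *m E))
    <= b * (6 * h * (t * e)) * (a * e).
  apply: spectral_normM_le (spectral_normM _ _); apply: spectral_normM_le (lexx _) _.
  exact: le_trans WYp_le h6.
have T3 : spectral_norm (E *m P *m (Yp *m W - Z *m Z^T) *m C)
    <= e * p * (6 * h * (t * e)) * g.
  apply: spectral_normM_le (lexx _); apply: spectral_normM_le (spectral_normM _ _) _.
  exact: le_trans YpW_le h6.
have T4 : spectral_norm (E *m P *m Yp *m (S^T *m E)) <= e * p * h * (a * e).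
  exact: spectral_normM_le (spectral_normM_le (spectral_normM _ _) Yp_le)
    (spectral_normM _ _).
apply: le_trans (spectral_normD _ _) _.
apply: le_trans (lerD (spectral_normD _ _) T4) _.
apply: le_trans (lerD (lerD (spectral_normD _ _) T3) (lexx _)) _.
apply: le_trans (lerD (lerD (lerD T1 T2) (lexx _)) (lexx _)) _.
(* The two sides differ by exactly e^2, the contribution of the added 1. *)
rewrite -subr_ge0; apply: le_trans (sqr_ge0 e) _.
by rewrite le_eqVlt; apply/orP; left; apply/eqP; ring.
Qed.

End CUR.

(** * Equivalence of norms on matrices *)

Section NormEquivalence.
Context {R : realType}.

Section Norm.
Variables (V : lmodType R) (N : V -> R).
Hypothesis normN : is_norm N.

Lemma is_norm0 : N 0 = 0.
Proof. by case: normN => _ NZ _; rewrite -(scale0r 0) NZ normr0 mul0r. Qed.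

Lemma is_normN x : N (- x) = N x.
Proof. by case: normN => _ NZ _; rewrite -scaleN1r NZ normrN1 mul1r. Qed.

Lemma is_norm_ge0 x : 0 <= N x.
Proof.
case: normN => ND _ _; have := ND x (- x); rewrite subrr is_norm0 is_normN.
by rewrite -mulr2n pmulrn_lge0.
Qed.

Lemma is_norm_gt0 x : x != 0 -> 0 < N x.
Proof.
case: normN => _ _ N0 x_neq0; rewrite lt_def is_norm_ge0 andbT.
by apply: contra_neq x_neq0; exact: N0.
Qed.

Lemma is_norm_dist x y : `|N x - N y| <= N (x - y).
Proof.
case: normN => ND _ _; have := ND (x - y) y; have := ND (y - x) x.
by rewrite !subrK -(opprB x y) is_normN ler_norml; lra.
Qed.

Lemma is_norm_sum (I : Type) (r : seq I) (F : I -> V) :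
  N (\sum_(i <- r) F i) <= \sum_(i <- r) N (F i).
Proof.
case: normN => ND _ _; elim: r => [|i r IHr]; first by rewrite !big_nil is_norm0.
by rewrite !big_cons (le_trans (ND _ _)) // lerD2l.
Qed.

End Norm.

Lemma is_norm_normr (V : normedModType R) : is_norm (fun x : V => `|x|).
Proof. by split; [exact: ler_normD | exact: normrZ | exact: normr0_eq0]. Qed.

Lemma is_norm_spectral m n : is_norm (@spectral_norm R m n).
Proof.
split; first exact: spectral_normD.
- have le a (X : 'M[R]_(m, n)) : spectral_norm (a *: X) <= `|a| * spectral_norm X.
    apply: spectral_norm_le => [|v]; first by rewrite mulr_ge0 ?spectral_norm_ge0.
    by rewrite -scalemxAl euclid_normZ -mulrA ler_wpM2l ?euclid_norm_mulmx.
  move=> a X; apply/eqP; rewrite eq_le le /=.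
  have [->|a_neq0] := eqVneq a 0; first by rewrite normr0 mul0r spectral_norm_ge0.
  rewrite mulrC -ler_pdivlMr ?normr_gt0 // mulrC -normfV.
  by apply: le_trans (le _ _); rewrite scalerA mulVf // scale1r.
- move=> X X0; apply/matrixP => i j; rewrite mxE; apply/eqP.
  have := le_trans (ler_entry_euclid_norm (X *m delta_mx j 0) i) (euclid_norm_mulmx _ _).
  by rewrite X0 mul0r -colE mxE normr_le0.
Qed.

Lemma is_norm_le_entries m n (N : 'M[R]_(m, n) -> R) : is_norm N ->
  exists2 K, 0 < K & forall (X : 'M[R]_(m, n)) b, 0 <= b ->
    (forall i j, `|X i j| <= b) -> N X <= K * b.
Proof.
move=> normN; exists (\sum_i \sum_j N (delta_mx i j) + 1).
  rewrite ltr_wpDl // sumr_ge0 // => i _.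
  by rewrite sumr_ge0 // => j _; exact: is_norm_ge0.
move=> X b b_ge0 Xb; rewrite mulrDl mul1r ler_wpDr // {1}(matrix_sum_delta X).
rewrite (le_trans (is_norm_sum normN _ _)) // mulr_suml ler_sum // => i _.
rewrite (le_trans (is_norm_sum normN _ _)) // mulr_suml ler_sum // => j _.
by case: (normN) => _ -> _; rewrite mulrC ler_wpM2l // is_norm_ge0.
Qed.

Lemma ler_entry_mx_norm m n (X : 'M[R]_(m, n)) i j : `|X i j| <= `|X|.
Proof.
have -> : `|X| = mx_norm X by [].
by rewrite mx_normrE; apply: (le_trans _ (le_bigmax _ _ (i, j))).
Qed.

Lemma is_norm_continuous n (N : 'rV[R]_n -> R) : is_norm N -> continuous N.
Proof.
move=> normN; have [K K_gt0 NK] := is_norm_le_entries normN.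
move=> x; apply/(@cvgrPdist_lt _ _ _ (nbhs x)) => eps eps_gt0; near=> y.
apply: le_lt_trans (is_norm_dist normN x y) _.
apply: le_lt_trans (NK _ `|x - y| _ _) _ => //; first exact: ler_entry_mx_norm.
rewrite mulrC -ltr_pdivlMr //; near: y.
by apply: cvgr_dist_lt => //; rewrite divr_gt0.
Unshelve. all: by end_near. Qed.

(** The continuous [N] attains a positive minimum on the compact unit sphere of the sup norm; its
    inverse is the constant. *)
Lemma rV_norm_ge n (N : 'rV[R]_n -> R) : is_norm N ->
  exists2 K, 0 < K & forall v : 'rV[R]_n, `|v| <= K * N v.
Proof.
move=> normN; pose A := [set v : 'rV[R]_n | `|v| = 1].
have normed (v : 'rV[R]_n) : v != 0 -> A (`|v|^-1 *: v).
  by move=> v_neq0; rewrite /A /= normrZ normfV normr_id mulVf ?normr_eq0.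
(* The sphere is empty when n = 0; then every vector is zero and any constant works. *)
have [A0|] := pselect (A !=set0); last first.
  move=> A0; exists 1 => // v; have [->|/normed Av] := eqVneq v 0.
    by rewrite normr0 mul1r is_norm_ge0.
  by case: A0; exists (`|v|^-1 *: v).
have cA : compact A.
  apply: bounded_closed_compact.
    by exists 1; split => // x x1 v /= ->; exact: ltW.
  apply: (@preimage_closed _ _ (fun v : 'rV[R]_n => `|v|) [set 1]).
    by move=> x _; exact: norm_continuous.
  exact: closed_eq.
have [v0 /set_mem Av0 v0_min] : exists2 v, v \in A & forall w, w \in A -> N v <= N w.
  by apply: compact_EVT_min => //; apply: continuous_subspaceT; exact: is_norm_continuous.
have Nv0_gt0 : 0 < N v0.
  apply: is_norm_gt0 => //; apply/eqP => v00; move: Av0.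
  by rewrite /A /= v00 normr0 => /esym/eqP; rewrite oner_eq0.
exists (N v0)^-1; first by rewrite invr_gt0.
move=> v; have [->|v_neq0] := eqVneq v 0.
  by rewrite normr0 mulr_ge0 ?invr_ge0 ?is_norm_ge0.
have := v0_min _ (mem_set (normed _ v_neq0)); case: (normN) => _ -> _.
rewrite normfV normr_id mulrC ler_pdivlMr ?normr_gt0 // => h.
by rewrite mulrC ler_pdivlMr // mulrC.
Qed.

(** Both norms are compared with the largest entry; for [N'] this goes through vectorization and the
    compactness argument on row vectors. *)
Lemma is_norm_equiv m n (N N' : 'M[R]_(m, n) -> R) : is_norm N -> is_norm N' ->
  exists2 K, 0 < K & forall X, N X <= K * N' X.
Proof.
move=> normN normN'; have [K K_gt0 NK] := is_norm_le_entries normN.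
have [|L L_gt0 NL] := @rV_norm_ge _ (N' \o vec_mx).
  case: (normN') => ND NZ N0; split => [x y|a x|x /N0 x0] /=.
  - by rewrite linearD.
  - by rewrite linearZ NZ.
  - by apply: (can_inj vec_mxK); rewrite x0 linear0.
exists (K * L); first exact: mulr_gt0.
move=> X; rewrite -mulrA.
have := NL (mxvec X); rewrite /= mxvecK => XL.
apply: NK => [|i j]; first exact: le_trans XL.
apply: le_trans XL; rewrite -mxvecE; exact: ler_entry_mx_norm.
Qed.

End NormEquivalence.

(** * Differentiability from a quadratic remainder, and assembly of the three claims *)

Lemma diff_quadratic_remainder (R : realType) (V W : normedModType R) (f : V -> W)
    (L : {linear V -> W}) (x : V) (k C delta : R) :
  (forall h, `|L h| <= k * `|h|) -> 0 < C -> 0 < delta ->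
  (forall h, `|h| <= delta -> `|f (x + h) - f x - L h| <= C * `|h| ^+ 2) ->
  differentiable f x /\ 'd f x = L :> (V -> W).
Proof.
move=> Lk C_gt0 delta_gt0 fL.
have Lcont : continuous L.
  apply/bounded_linear_continuous/linear_boundedP.
  near=> r => h; apply: le_trans (Lk h) _.
  by rewrite ler_wpM2r //; near: r; exact: nbhs_pinfty_ge.
have expand : f \o shift x = cst (f x) + L +o_ 0 id.
  apply/eqaddoP => _/posnumP[eps]; near=> h.
  have -> : (f \o shift x - (cst (f x) + L)) h = f (x + h) - f x - L h.
    by rewrite !fctE /= opprD addrA [h + x]addrC.
  apply: le_trans (fL h _) _.
    by near: h; apply: nbhs0_le.
  (* C |h|^2 <= eps |h| as soon as |h| <= eps / C. *)
  rewrite expr2 mulrA ler_wpM2r // -ler_pdivlMl //.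
  by near: h; apply: nbhs0_le; rewrite mulr_gt0 ?invr_gt0.
have dfL := diff_unique Lcont expand.
by split=> //; apply/diff_locallyP; rewrite dfL.
Unshelve. all: by end_near. Qed.

Lemma oblique_tangent_proj_is_linear (R : realType) m n s c r
    (S : 'M[R]_(m, s)) (P : 'M[R]_(n, c)) (U : 'M[R]_(m, r)) (V : 'M[R]_(n, r)) :
  linear (oblique_tangent_proj S P U V).
Proof.
move=> a E F; rewrite /oblique_tangent_proj !(mulmxDl, mulmxDr) -!(scalemxAl, scalemxAr).
by rewrite !scalerDr scalerN opprD [X in X + _]addrACA [LHS]addrACA.
Qed.

HB.instance Definition _ (R : realType) m n s c r
    (S : 'M[R]_(m, s)) (P : 'M[R]_(n, c)) (U : 'M[R]_(m, r)) (V : 'M[R]_(n, r)) :=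
  GRing.isLinear.Build R 'M[R]_(m, n) 'M[R]_(m, n) *:%R
    (oblique_tangent_proj S P U V) (oblique_tangent_proj_is_linear S P U V).

(** Boundedness gives the continuity required of the candidate differential. *)
Lemma spectral_norm_oblique_tangent_proj (R : realType) m n s c r
    (S : 'M[R]_(m, s)) (P : 'M[R]_(n, c)) (U : 'M[R]_(m, r)) (V : 'M[R]_(n, r)) E :
  spectral_norm (oblique_tangent_proj S P U V E) <=
    (spectral_norm (oblique_left S U) + spectral_norm (oblique_right P V)
     + spectral_norm (oblique_left S U) * spectral_norm (oblique_right P V))
    * spectral_norm E.
Proof.
rewrite /oblique_tangent_proj.
have aE := spectral_normM (oblique_left S U) E.
apply: le_trans (spectral_normB _ _) _.
apply: le_trans (lerD (spectral_normD _ _) (spectral_normM_le aE (lexx _))) _.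
apply: le_trans (lerD (lerD aE (spectral_normM _ _)) (lexx _)) _.
by rewrite le_eqVlt; apply/orP; left; apply/eqP; ring.
Qed.

Theorem theorem3p1 (R : realType) (m n s c r : nat)
  (M : 'M[R]_(m, n)) (U : 'M[R]_(m, r)) (d : 'rV[R]_r) (V : 'M[R]_(n, r))
  (S : 'M[R]_(m, s)) (P : 'M[R]_(n, c))
  (trunc : 'M[R]_(s, c) -> 'M[R]_(s, c))
  (r_gt0 : (0 < r)%N)
  (svdM : compact_svd M U d V)
  (selS : selection_mx S) (selP : selection_mx P)
  (admSP : admissible S P U V)
  (truncP : forall X, svd_truncation r X (trunc X)) :
  let Phi := CUR_map S P trunc in
  let W := S^T *m M *m P in
  [/\ differentiable Phi M /\
      (forall E : 'M[R]_(m, n),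
        'd Phi M E = oblique_tangent_proj S P U V E),
      (forall N : 'M[R]_(m, n) -> R, is_norm N ->
        exists C delta : R, [/\ 0 < C, 0 < delta &
          forall E : 'M[R]_(m, n), N E <= delta ->
            N (Phi (M + E) - M - oblique_tangent_proj S P U V E)
              <= C * N E ^+ 2])
    & (forall kappa : R, 0 < kappa -> kappa < 1 / 2 ->
        forall E : 'M[R]_(m, n),
        let Delta := S^T *m E *m P in
        spectral_norm Delta <= kappa * singular_value r W ->
        forall (Q : 'M[R]_(s, r)) (l : 'rV[R]_r) (Z : 'M[R]_(c, r)),
        compact_svd W Q l Z ->
        exists2 Rem : 'M[R]_(s, c),
          trunc (W + Delta) = W + tangent_proj Q Z Delta + Rem
        & spectral_norm Rem <= (12 - 16 * kappa) / (1 - 2 * kappa)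
            * (spectral_norm Delta ^+ 2 / singular_value r W))].
Proof.
move=> Phi W.
have expansion (N : 'M[R]_(m, n) -> R) : is_norm N ->
    exists C delta : R, [/\ 0 < C, 0 < delta &
      forall E : 'M[R]_(m, n), N E <= delta ->
        N (Phi (M + E) - M - oblique_tangent_proj S P U V E) <= C * N E ^+ 2].
  move=> normN.
  have [K [delta [K_gt0 delta_gt0 PhiE]]] := CUR_map_expansion svdM admSP r_gt0 truncP.
  have [a a_gt0 Na] := is_norm_equiv normN (is_norm_spectral m n).
  have [b b_gt0 Nb] := is_norm_equiv (is_norm_spectral m n) normN.
  (* With N <= a |.| and |.| <= b N for the spectral norm |.|, the upper bound picks up [a], the
     square on the right [b ^+ 2], and the radius shrinks by [b]. *)
  exists (a * (K * b ^+ 2)), (delta / b); split.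
  - by rewrite !mulr_gt0 // exprn_gt0.
  - by rewrite divr_gt0.
  move=> E; rewrite ler_pdivlMr // mulrC => E_le.
  apply: le_trans (Na _) _; rewrite -mulrA ler_pM2l //.
  apply: le_trans (PhiE _ (le_trans (Nb _) E_le)) _.
  rewrite -mulrA ler_pM2l // -exprMn.
  by rewrite lerXn2r ?nnegrE ?spectral_norm_ge0 ?mulr_ge0 ?is_norm_ge0 // ltW.
split=> //.
- have [C [delta [C_gt0 delta_gt0 PhiE]]] := expansion _ (is_norm_normr 'M[R]_(m, n)).
  (* Exactness at [M] is the quadratic bound at E = 0. *)
  have PhiM : Phi M = M.
    have := PhiE 0; rewrite normr0 addr0 [oblique_tangent_proj _ _ _ _ _]linear0 subr0.
    move=> /(_ (ltW delta_gt0)); rewrite expr0n mulr0 normr_le0 subr_eq0.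
    by move/eqP.
  have [a a_gt0 Na] := is_norm_equiv (is_norm_normr 'M[R]_(m, n)) (is_norm_spectral m n).
  have [b b_gt0 Nb] := is_norm_equiv (is_norm_spectral m n) (is_norm_normr 'M[R]_(m, n)).
  set k := spectral_norm (oblique_left S U) + spectral_norm (oblique_right P V)
    + spectral_norm (oblique_left S U) * spectral_norm (oblique_right P V).
  have k_ge0 : 0 <= k by rewrite !addr_ge0 ?mulr_ge0 ?spectral_norm_ge0.
  have L_le E : `|oblique_tangent_proj S P U V E| <= a * (k * b) * `|E|.
    apply: le_trans (Na _) _; rewrite -!mulrA ler_pM2l //.
    apply: le_trans (spectral_norm_oblique_tangent_proj _ _ _ _ _) _.
    by rewrite -/k ler_wpM2l.
  have Phi_near h : `|h| <= delta ->
      `|Phi (M + h) - Phi M - oblique_tangent_proj S P U V h| <= C * `|h| ^+ 2.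
    by rewrite PhiM; exact: PhiE.
  have [dPhi dE] := diff_quadratic_remainder
    (L := oblique_tangent_proj S P U V) L_le C_gt0 delta_gt0 Phi_near.
  by split=> // E; rewrite dE.
- move=> kappa kappa_gt0 kappa_lt E Delta Delta_le Q l Z svdW.
  have [_ [_ [_ [_ w_gt0 _]]]] := singular_value_last r_gt0 svdW.
  have w_le := singular_value_le svdW.
  set w := singular_value r W in w_gt0 w_le Delta_le *.
  have XW : W + Delta - W = Delta by rewrite addrC addKr.
  have k_gt0 : 0 < 1 - 2 * kappa by lra.
  (* Here [kappa] enters: the smallness of [Delta] keeps the denominator s - 2 e of the expansion,
     at s = w, proportional to [w]. *)
  have gap : (1 - 2 * kappa) * w <= w - 2 * spectral_norm Delta by lra.
  have gap_gt0 : 0 < (1 - 2 * kappa) * w by exact: mulr_gt0.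
  have near : 2 * spectral_norm (W + Delta - W) < w by rewrite XW; lra.
  have := truncation_expansion svdW w_le near (truncP _); rewrite XW => Rem_le.
  exists (trunc (W + Delta) - (W + tangent_proj Q Z Delta)).
    by rewrite [RHS]addrC subrK.
  apply: le_trans Rem_le _; set e2 := spectral_norm Delta ^+ 2.
  have e2w_ge0 : 0 <= e2 / w by rewrite divr_ge0 ?sqr_ge0 // ltW.
  apply: (@le_trans _ _ (4 * e2 / w + 4 * e2 / ((1 - 2 * kappa) * w))).
    have e2_ge0 : 0 <= 4 * e2 by rewrite mulr_ge0 // sqr_ge0.
    by rewrite lerD2l ler_wpM2l // lef_pV2 ?posrE // (lt_le_trans gap_gt0 gap).
  (* The stated constant is 8 + 4 / (1 - 2 kappa), while the bound reached so far has 4 + 4 / (1 - 2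
     kappa). *)
  have -> : (12 - 16 * kappa) / (1 - 2 * kappa) * (e2 / w) =
      4 * e2 / w + 4 * e2 / ((1 - 2 * kappa) * w) + 4 * (e2 / w).
    by field; rewrite !gt_eqF.
  by rewrite lerDl mulr_ge0.
Qed.
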